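(* Let $X$ be a nonrigid trinomial hypersurface. Then the number of $\mathrm{Aut}(X)$-orbits on $X$ is finite.
   Context: $\mathbb{K}$ is an algebraically closed field of characteristic zero. Fix $n=n_0+n_1+n_2$ with $n_0\ge 0$ and $n_1,n_2\ge 1$ integers, and let $T_{ij}$ ($i\in\{0,1,2\}$, $1\le j\le n_i$) be the coordinates on $\mathbb{K}^n$. A trinomial hypersurface is a subvariety $X\subset\mathbb{K}^n$ given by the equation $T_0^{l_0}+T_1^{l_1}+T_2^{l_2}=0$, where $T_i^{l_i}=T_{i1}^{l_{i1}}T_{i2}^{l_{i2}}\cdots T_{in_i}^{l_{in_i}}$ and all $l_{ij}$ are positive integers; if $n_0=0$, then $T_0^{l_0}$ means $1$. A derivation $\partial$ of an algebra $A$ is locally nilpotent (an LND) if for every $a\in A$ there is $n\ge1$ with $\partial^n(a)=0$. An affine variety $X$ is rigid if $\mathbb{K}[X]$ admits no nonzero LND. $\mathrm{Aut}(X)$ is the group of all regular automorphisms of $X$. *)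

(* Defs.v *)
From HB Require Import structures.
From mathcomp Require Import all_boot all_order all_algebra.
From mathcomp Require Import mpoly.
From mathcomp Require Import boolp classical_sets functions cardinality.

Set Implicit Arguments.
Unset Strict Implicit.
Unset Printing Implicit Defensive.

Import GRing.Theory.
Local Open Scope classical_set_scope.
Local Open Scope ring_scope.

(* The blocks of variables T_{0j}, T_{1j}, T_{2j} are consecutive. For n0 = 0
   the first product is empty, so the first term is 1. *)
Definition trinomial (K : closedFieldType) (n0 n1 n2 : nat)
    (l0 : 'I_n0 -> nat) (l1 : 'I_n1 -> nat) (l2 : 'I_n2 -> nat) :
    {mpoly K[n0 + n1 + n2]} :=
  \prod_(j < n0) 'X_(lshift n2 (lshift n1 j)) ^+ l0 j
  + \prod_(j < n1) 'X_(lshift n2 (rshift n0 j)) ^+ l1 j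
  + \prod_(j < n2) 'X_(rshift (n0 + n1) j) ^+ l2 j.

Definition hypersurface (K : closedFieldType) (n : nat) (F : {mpoly K[n]}) :
    set 'rV[K]_n :=
  [set x | F.@[fun i => x ord0 i] = 0].

Definition trinomial_hypersurface (K : closedFieldType) (n0 n1 n2 : nat)
    (l0 : 'I_n0 -> nat) (l1 : 'I_n1 -> nat) (l2 : 'I_n2 -> nat) :
    set 'rV[K]_(n0 + n1 + n2) :=
  hypersurface (trinomial K l0 l1 l2).
Arguments trinomial_hypersurface K {n0 n1 n2} l0 l1 l2 _ : assert.

Section CoordinateRing.
Variables (K : closedFieldType) (n : nat) (X : set 'rV[K]_n).

(* K^o is K seen as a module over itself; it gives the functions X -> K both
   their pointwise K-module and their pointwise ring structure. *)
Definition regular_function : {pred X -> K^o} :=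
  fun f => `[< exists p : {mpoly K[n]},
                 forall x : X, f x = p.@[fun i => set_val x ord0 i] >].

Lemma regular_functionP (f : X -> K^o) :
  reflect (exists p : {mpoly K[n]},
             forall x : X, f x = p.@[fun i => set_val x ord0 i])
          (f \in regular_function).
Proof. exact: asboolP. Qed.

Fact regular_function_subring : subring_closed regular_function.
Proof.
split.
- by apply/regular_functionP; exists 1 => x; rewrite meval1.
- move=> f g /regular_functionP[p fp] /regular_functionP[q gq].
  by apply/regular_functionP; exists (p - q) => x; rewrite mevalB -fp -gq.
- move=> f g /regular_functionP[p fp] /regular_functionP[q gq].
  by apply/regular_functionP; exists (p * q) => x; rewrite mevalM -fp -gq.
Qed.

Fact regular_function_scale : scaler_closed regular_function.
Proof.
move=> a f /regular_functionP[p fp].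
by apply/regular_functionP; exists (a *: p) => x; rewrite mevalZ -fp.
Qed.

HB.instance Definition _ :=
  GRing.isSubringClosed.Build (X -> K^o) regular_function
    regular_function_subring.
HB.instance Definition _ :=
  GRing.isScaleClosed.Build K (X -> K^o) regular_function
    regular_function_scale.

(* The algebra K[X]. It is only a possibly trivial ring because X is not
   assumed to be nonempty. *)
Record coordinate_ring := CoordinateRing {
  coordinate_ring_val :> X -> K^o;
  _ : coordinate_ring_val \in regular_function
}.

HB.instance Definition _ := [isSub for coordinate_ring_val].
HB.instance Definition _ := [Choice of coordinate_ring by <:].
HB.instance Definition _ :=
  GRing.SubChoice_isSubComPzRing.Build (X -> K^o) regular_function
    coordinate_ring regular_function_subring.
HB.instance Definition _ := [SubZmodule_isSubLmodule of coordinate_ring by <:].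

Lemma coordinate_ring_scalerAl (a : K) (f g : coordinate_ring) :
  a *: (f * g) = (a *: f) * g.
Proof. by apply/val_inj/funext => x; exact: (mulrA a (val f x) (val g x)). Qed.

Definition derivation (D : {linear coordinate_ring -> coordinate_ring}) :=
  forall f g : coordinate_ring, D (f * g) = D f * g + f * D g.

Definition locally_nilpotent
    (D : {linear coordinate_ring -> coordinate_ring}) :=
  forall f : coordinate_ring, exists m : nat, (1 <= m)%N /\ iter m D f = 0.

Definition rigid :=
  forall D : {linear coordinate_ring -> coordinate_ring},
    derivation D -> locally_nilpotent D ->
    forall f : coordinate_ring, D f = 0.

Definition regular_map (f : X -> X) :=
  forall i : 'I_n, (fun x : X => set_val (f x) ord0 i) \in regular_function.

Definition Aut : set (X -> X) :=
  [set f | regular_map f /\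
           exists g : X -> X, [/\ regular_map g, cancel f g & cancel g f]].

Definition Aut_orbit (x : X) : set X := [set f x | f in Aut].

End CoordinateRing.

(* Main.v *)
Require Import Defs.
From mathcomp Require Import all_boot all_order all_algebra.
From mathcomp Require Import mpoly ring.
From mathcomp Require Import separable.
From mathcomp Require Import boolp classical_sets functions cardinality.

(** Write [T0], [T1], [T2] for the three monomials, so that the hypersurface
    [X] is [T0 + T1 + T2 = 0]. The proof does not classify the nonrigid
    trinomial hypersurfaces: one locally nilpotent derivation, whatever it is,
    is enough, together with the diagonal automorphisms.

    The quasitorus of diagonal matrices that multiply [T0], [T1], [T2] by a
    common factor acts on [X] ([torus_orbit]). It has finitely many orbits on
    the union of the coordinate hyperplanes, one for each possible set of vanishing
    coordinates, and a one-parameter family of orbits off the hyperplanes,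
    parametrized by the ratio [T1 / T0]. It remains to join all but finitely
    many members of this family by automorphisms.

    A locally nilpotent derivation [D] integrates to a one-parameter group of
    automorphisms, and each regular function restricted to the curve of this
    group through a point [x] is a polynomial in the time ([flow_poly]). If
    [T1 / T0] is not constant along some such curve, then this nonconstant
    rational function on the affine line omits only finitely many values
    ([wronskian_surj]), so the curve, which lies in one orbit of [Aut], meets
    all but finitely many torus orbits of the family
    ([orbits_finite_of_wronskian]).

    If instead the ratio is constant along every curve, then [D = 0]
    ([derivation_eq0]). Indeed [T0] vanishes on the whole curve through any
    point with [T0 = 0] and [T1 != 0], and such points are dense in the
    divisor [T0 = 0] of [X]; so this divisor is invariant
    ([divisor_invariant]). The curve through a point off the coordinate
    hyperplanes then avoids it, and along this curve the polynomial [T0] has no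
    zero and is constant, hence so are [T1], [T2] and all the coordinates. Thus
    [D] kills the coordinates on a dense subset of [X].

    Both density statements are instances of [block_dense], on hypersurfaces
    [T + B = 0] where [B] does not involve the variables of the monomial [T].
    It is reduced to plane curves [y^k = b(t)], where it follows from
    division by a monic polynomial ([radical_curve_dense]); this replaces the
    Nullstellensatz for the ideal of [X]. *)

Set Implicit Arguments.
Unset Strict Implicit.
Unset Printing Implicit Defensive.

Import GRing.Theory.
Local Open Scope classical_set_scope.
Local Open Scope ring_scope.

(** * Substitution in multivariate polynomials *)

Lemma mpoly_ring_ind (R : nzRingType) (n : nat) (P : {mpoly R[n]} -> Prop) :
  (forall c, P c%:MP) -> (forall i, P 'X_i) ->
  (forall p q, P p -> P q -> P (p + q)) ->
  (forall p q, P p -> P q -> P (p * q)) -> forall p, P p.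
Proof.
move=> PC PX PD PM p; rewrite (mpolyE p).
apply: (big_ind P) => [|//|m _]; first by rewrite -[0]mpolyC0.
rewrite -mul_mpolyC; apply: (PM _ _ (PC _)); rewrite mpolyXE_id.
apply: (big_ind P) => [|//|i _]; first by rewrite -mpolyC1.
by elim: (m i) => [|k IHk]; [rewrite expr0 -mpolyC1 | rewrite exprS; apply: PM].
Qed.

(** Serves to pull polynomials back along curves, surfaces and regular maps:
    their coordinates lie in a class [S] of functions for which membership
    says that the function is itself polynomial, or regular. *)
Lemma meval_closed (R : comNzRingType) (n : nat) (A : Type)
    (S : (A -> R) -> Prop) :
  (forall c, S (fun=> c)) ->
  (forall f g, S f -> S g -> S (fun a => f a + g a)) ->
  (forall f g, S f -> S g -> S (fun a => f a * g a)) ->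
  forall (p : {mpoly R[n]}) (v : A -> 'I_n -> R),
    (forall i, S (v^~ i)) -> S (fun a => p.@[v a]).
Proof.
move=> SC SD SM p v Sv; elim/mpoly_ring_ind: p => [c|i|p q Sp Sq|p q Sp Sq].
- rewrite (_ : (fun _ => _) = (fun=> c)) //.
  by apply: funext => a; rewrite mevalC.
- by rewrite (_ : (fun _ => _) = v^~ i) //; apply: funext => a; rewrite mevalXU.
- rewrite (_ : (fun _ => _) = (fun a => p.@[v a] + q.@[v a])); first exact: SD.
  by apply: funext => a; rewrite mevalD.
- rewrite (_ : (fun _ => _) = (fun a => p.@[v a] * q.@[v a])); first exact: SM.
  by apply: funext => a; rewrite mevalM.
Qed.

Section PolynomialMaps.
Variables (R : comNzRingType) (n : nat) (p : {mpoly R[n]}).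

Lemma meval_poly (v : R -> 'I_n -> R) :
  (forall i, exists q : {poly R}, forall t, v t i = q.[t]) ->
  exists q : {poly R}, forall t, p.@[v t] = q.[t].
Proof.
apply: (meval_closed (S := fun f =>
  exists q : {poly R}, forall t, f t = q.[t])).
- by move=> c; exists c%:P => t; rewrite hornerC.
- by move=> f g [q1 e1] [q2 e2]; exists (q1 + q2) => t; rewrite hornerD e1 e2.
- by move=> f g [q1 e1] [q2 e2]; exists (q1 * q2) => t; rewrite hornerM e1 e2.
Qed.

Lemma meval_poly2 (v : R * R -> 'I_n -> R) :
  (forall i, exists q : {poly {poly R}}, forall a, v a i = q.[a.2%:P].[a.1]) ->
  exists q : {poly {poly R}}, forall a, p.@[v a] = q.[a.2%:P].[a.1].
Proof.
apply: (meval_closed (S := fun f =>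
  exists q : {poly {poly R}}, forall a : R * R, f a = q.[a.2%:P].[a.1])).
- by move=> c; exists c%:P%:P => a; rewrite !hornerC.
- by move=> f g [q1 e1] [q2 e2]; exists (q1 + q2) => a; rewrite !hornerD e1 e2.
- by move=> f g [q1 e1] [q2 e2]; exists (q1 * q2) => a; rewrite !hornerM e1 e2.
Qed.

Lemma meval_zero_coord (i : 'I_n) : exists p' : {mpoly R[n]},
  forall v, p'.@[v] = p.@[fun k => if k == i then 0 else v k].
Proof.
have [] := meval_closed (S := fun h : ('I_n -> R) -> R =>
  exists p' : {mpoly R[n]}, forall v, h v = p'.@[v]) _ _ _ p
  (v := fun v k => if k == i then 0 else v k).
- by move=> c; exists c%:MP => v; rewrite mevalC.
- by move=> f g [q1 e1] [q2 e2]; exists (q1 + q2) => v; rewrite mevalD e1 e2.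
- by move=> f g [q1 e1] [q2 e2]; exists (q1 * q2) => v; rewrite mevalM e1 e2.
- move=> k; case: (k == i); first by exists 0 => v; rewrite meval0.
  by exists 'X_k => v; rewrite mevalXU.
- by move=> p' pE; exists p' => v.
Qed.

End PolynomialMaps.

(** * Univariate polynomials over an algebraically closed field *)

Section ClosedField.
Variable K : closedFieldType.
Implicit Types p q : {poly K}.

(** A zero of [p * 'X + 1] is a point where [p] does not vanish. *)
Lemma poly_eq0_horner p : (forall t, p.[t] = 0) -> p = 0.
Proof.
move=> p0; apply/eqP/contraT => nz_p.
have: size (p * 'X + 1) != 1.
  rewrite -[1]/(1%:P) size_MXaddC (negPf nz_p) /=.
  by rewrite -[1%R]/1%N eqSS size_poly_eq0.
case/closed_rootP => r; rewrite rootE !hornerE p0 mul0r add0r.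
by rewrite oner_eq0.
Qed.

Lemma poly_eq0_dense p q :
  q != 0 -> (forall t, q.[t] != 0 -> p.[t] = 0) -> p = 0.
Proof.
move=> nz_q pq; have: p * q = 0.
  apply: poly_eq0_horner => t; rewrite hornerM.
  by have [->|/pq->] := eqVneq q.[t] 0; rewrite ?mulr0 ?mul0r.
by move/eqP; rewrite mulf_eq0 (negPf nz_q) orbF => /eqP.
Qed.

Hypothesis charK0 : [pchar K] =i pred0.

Lemma natr_neq0 k : (0 < k)%N -> k%:R != 0 :> K.
Proof. by rewrite lt0n => ?; move/pcharf0P: charK0 => ->. Qed.

Lemma uniq_kth_roots k (c : K) : (0 < k)%N -> c != 0 ->
  exists r : seq K, [/\ size r = k, uniq r & all (fun z => z ^+ k == c) r].
Proof.
move=> k_gt0 nz_c; have mon := monicXnsubC c k_gt0.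
have [r Dr] := closed_field_poly_normal ('X^k - c%:P : {poly K}).
have{Dr} Dr : 'X^k - c%:P = \prod_(z <- r) ('X - z%:P).
  by rewrite Dr (monicP mon) scale1r.
exists r; split.
- by apply/eq_add_S; rewrite -(size_prod_XsubC r id) -Dr size_XnsubC.
- rewrite -separable_prod_XsubC -Dr unlock.
  apply: Pdiv.ClosedField.root_coprimep => x.
  rewrite derivB derivC subr0 derivXn hornerMn hornerXn rootE !hornerE.
  rewrite subr_eq0 => /eqP xk; rewrite -mulr_natr mulf_neq0 ?natr_neq0 //.
  rewrite expf_neq0 //; apply: contra_neq nz_c => x0.
  by rewrite -xk x0 expr0n gtn_eqF.
- apply/allP => z; rewrite -root_prod_XsubC -Dr rootE !hornerE.
  by rewrite subr_eq0.
Qed.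

Lemma horner_map_eval (P : {poly {poly K}}) t y :
  (map_poly (horner_eval t) P).[y] = P.[y%:P].[t].
Proof.
rewrite -[y in LHS](hornerC y t).
by rewrite -[_.[t] in LHS]/(horner_eval t y%:P) horner_map.
Qed.

(** After division of [P] by the monic polynomial [Y^k - b], the remainder has
    degree less than [k] in [Y] but, for general [t], it vanishes at the [k]
    distinct roots of [b(t)]. So it is [0], and the equality [P = Q * (Y^k - b)]
    also holds over the special values of [t]. *)
Lemma radical_curve_dense k (b e : {poly K}) (P : {poly {poly K}}) :
    (0 < k)%N -> b != 0 -> e != 0 ->
    (forall t y, y ^+ k = b.[t] -> b.[t] != 0 -> e.[t] != 0 ->
       P.[y%:P].[t] = 0) ->
  forall t y, y ^+ k = b.[t] -> P.[y%:P].[t] = 0.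
Proof.
move=> k_gt0 nz_b nz_e Pgen.
pose M : {poly {poly K}} := 'X^k - b%:P.
have monM : M \is monic by apply: monicXnsubC.
have ME t y : y ^+ k = b.[t] -> M.[y%:P].[t] = 0.
  by rewrite /M !(hornerE, horner_exp) => ->; rewrite subrr.
have sizeM : size M = k.+1 by apply: size_XnsubC.
clearbody M.
have PE := Pdiv.IdomainMonic.divp_eq monM P.
set R := modp P M in PE.
have R0 : R = 0.
  have ltR : (size R <= k)%N.
    rewrite -ltnS -sizeM Pdiv.CommonIdomain.ltn_modp.
    exact: monic_neq0.
  apply/polyP => i; rewrite coef0.
  apply: (@poly_eq0_dense _ (b * e)); first by rewrite mulf_neq0.
  move=> t; rewrite hornerM mulf_eq0 negb_or => /andP[bt et].
  have [r [sr ur /allP rk]] := uniq_kth_roots k_gt0 bt.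
  have Rt0 : map_poly (horner_eval t) R = 0.
    apply/eqP/contraT => nz; have := max_poly_roots nz _ ur.
    rewrite sr leqNgt ltnS (leq_trans (size_poly _ _)) //=; last first.
    move=> -> //; apply/allP => z zr; rewrite rootE horner_map_eval.
    have zk : z ^+ k = b.[t] by apply/eqP; apply: rk.
    have := Pgen t z zk bt et; rewrite PE !hornerE ME // mulr0 add0r.
    by move=> ->.
  by rewrite -[LHS]/(horner_eval t R`_i) -coef_map Rt0 coef0.
by move=> t y yk; rewrite PE R0 addr0 !hornerE ME // mulr0.
Qed.

(** If the wronskian of [p] and [q] vanishes then [p / q] is constant; here the
    constant is [0]. Lowest terms suffice to see it: if [p = c * 'X^m + ...],
    the lowest term of [q * p^`()] is [m * c * q.[0] * 'X^(m-1)], while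
    [p * q^`()] is divisible by ['X^m]. *)
Lemma wronskian0_eq0 p q : p * q^`() = q * p^`() ->
  p.[0] = 0 -> q.[0] != 0 -> p = 0.
Proof.
move=> W p0 q0; apply/eqP/contraT => nz_p.
have [m [r /implyP/(_ nz_p) nz_r Dp]] := multiplicity_XsubC p 0.
rewrite subr0 in Dp; case: m => [|m] in Dp.
  by move: nz_r; rewrite rootE -[r]mulr1 -(expr0 'X) -Dp p0 eqxx.
have: 'X^m * (r * 'X * q^`() - q * (r^`() * 'X + r *+ m.+1)) = 0.
  have: p * q^`() - q * p^`() = 0 by rewrite W subrr.
  rewrite Dp derivM derivXn /= => <-.
  rewrite -[_ *+ m.+1 in LHS]mulr_natr -['X^m *+ _]mulr_natr exprS; ring.
move/eqP; rewrite mulf_eq0 expf_eq0 polyX_eq0 andbF /= => /eqP.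
move/(congr1 (fun u => u.[0])); rewrite !hornerE hornerMn => /eqP.
rewrite oppr_eq0 -mulr_natr !mulf_eq0.
by rewrite (negPf q0) (negPf (natr_neq0 _)) // orbF /= -rootE (negPf nz_r).
Qed.

(** In lowest terms, the rational function [q / p] omits the value [c] only if
    [q - c * p] is constant, which happens for at most one [c] as the function
    is not constant. The other exceptions come from the common zeros of [p] and
    [q]: the values that the reduced fraction takes there. *)
Lemma wronskian_surj p q : p * q^`() != q * p^`() ->
  exists r : seq K, forall c, c \notin r ->
    exists2 s, q.[s] = c * p.[s] & p.[s] != 0.
Proof.
move=> W; have nz_p : p != 0.
  by apply: contra_neq W => ->; rewrite deriv0 mul0r mulr0.
set g := gcdp p q; have nz_g : g != 0 by rewrite gcdp_eq0 (negPf nz_p).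
pose p1 := p %/ g; pose q1 := q %/ g.
have Dp : p = p1 * g by rewrite divpK ?dvdp_gcdl.
have Dq : q = q1 * g by rewrite divpK ?dvdp_gcdr.
have cop : coprimep p1 q1 by apply: coprimep_div_gcd; rewrite nz_p.
have W1 : p1 * q1^`() != q1 * p1^`().
  apply: contra_neq W => W1; rewrite Dp Dq !derivM.
  transitivity (p1 * q1^`() * g ^+ 2 + p1 * g * q1 * g^`()); first by ring.
  by rewrite W1; ring.
have [rg Dg] := closed_field_poly_normal g.
(* The exceptional value, if any, for which [q1 - c * p1] is constant. *)
have [r0 r0P] : exists r0 : seq K, forall c, c \notin r0 ->
    size (q1 - c *: p1) != 1.
  have [[c0 /eqP sc0]|no] := pselect (exists c, size (q1 - c *: p1) == 1).
    exists [:: c0] => c; rewrite inE => ne_c; apply/eqP => sc.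
    have /size_poly1P[a _ Da] : size (q1 - c *: p1) == 1 by apply/eqP.
    have /size_poly1P[a0 _ Da0] : size (q1 - c0 *: p1) == 1 by apply/eqP.
    have Ep : (c0 - c) *: p1 = (a - a0)%:P.
      by rewrite polyCB -Da -Da0 scalerBl; ring.
    have {}Ep : p1 = ((c0 - c)^-1 * (a - a0))%:P.
      by rewrite polyCM mul_polyC -Ep scalerK // subr_eq0 eq_sym.
    have Eq : q1 = (a + c * ((c0 - c)^-1 * (a - a0)))%:P.
      by rewrite polyCD polyCM -Ep -Da mul_polyC subrK.
    by move: W1; rewrite Ep Eq !derivC !mulr0 eqxx.
  by exists [::] => c _; apply/negP => sc; apply: no; exists c.
exists (r0 ++ [seq q1.[s] / p1.[s] | s <- rg]) => c.
rewrite mem_cat negb_or => /andP[/r0P/closed_rootP[s]].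
rewrite rootE !hornerE subr_eq0 => /eqP qs ncr.
have ps : p1.[s] != 0.
  apply/negP => ps; have := coprimep_root cop ps.
  by rewrite qs (eqP ps) mulr0 eqxx.
have gs : g.[s] != 0.
  rewrite Dg hornerZ mulf_neq0 ?lead_coef_eq0 // -rootE root_prod_XsubC.
  apply: contra ncr => s_rg; apply/mapP; exists s => //.
  by rewrite qs mulfK.
by exists s; rewrite Dp ?Dq !hornerM ?mulf_neq0 // qs mulrA.
Qed.

End ClosedField.

(** * Density on hypersurfaces linear in a monomial *)

Definition block_monomial (R : nzRingType) (n m : nat) (f : 'I_m -> 'I_n)
    (l : 'I_m -> nat) : {mpoly R[n]} := \prod_(j < m) 'X_(f j) ^+ l j.

Lemma meval_block (R : comNzRingType) (n m : nat) (f : 'I_m -> 'I_n)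
    (l : 'I_m -> nat) (v : 'I_n -> R) :
  (block_monomial R f l).@[v] = \prod_(j < m) v (f j) ^+ l j.
Proof.
by rewrite rmorph_prod; apply: eq_bigr => j _; rewrite rmorphXn /= mevalXU.
Qed.

Lemma block_at1 (R : comNzRingType) (n m : nat) (f : 'I_m -> 'I_n) l :
  (block_monomial R f l).@[fun=> 1] = 1.
Proof. by rewrite meval_block big1 // => j _; rewrite expr1n. Qed.

Section Density.
Variables (K : closedFieldType) (charK0 : [pchar K] =i pred0).
Variables (n m : nat) (f : 'I_m -> 'I_n) (l : 'I_m -> nat).
Hypotheses (f_inj : injective f) (l_gt0 : forall j, (0 < l j)%N).

Definition block_free (B : {mpoly K[n]}) := forall v w : 'I_n -> K,
  (forall k, (forall j, k != f j) -> v k = w k) -> B.@[v] = B.@[w].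

Local Notation T := (block_monomial K f l).
Variables B e g : {mpoly K[n]}.
Hypotheses (freeB : block_free B) (freee : block_free e).
Hypotheses (B1 : B.@[fun=> 1] != 0) (e1 : e.@[fun=> 1] != 0).
Hypothesis g_gen : forall v : 'I_n -> K,
  T.@[v] + B.@[v] = 0 -> B.@[v] != 0 -> e.@[v] != 0 -> g.@[v] = 0.

(** The variables outside the block move along the line towards the point all
    of whose coordinates are [1], and the block variables other than [f j0]
    stay fixed, so that the equation [T + B = 0] becomes [y ^+ l j0 = b(t)]. *)
Lemma block_dense_one (v0 : 'I_n -> K) (j0 : 'I_m) :
    (forall j, j != j0 -> v0 (f j) != 0) -> T.@[v0] + B.@[v0] = 0 ->
  g.@[v0] = 0.
Proof.
move=> nz_v0 Fv0.
pose c (a : K * K) k := if k == f j0 then a.2 else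
  if [exists j, k == f j] then v0 k else v0 k + a.1 * (1 - v0 k).
have c_poly k : exists q : {poly {poly K}},
    forall a, c a k = q.[a.2%:P].[a.1].
  rewrite /c; case: (k == f j0); first by exists 'X => a; rewrite !hornerE.
  case: [exists j, k == f j].
    by exists (v0 k)%:P%:P => a; rewrite !hornerE.
  by exists ((v0 k)%:P + 'X * (1 - v0 k)%:P)%:P => a; rewrite !hornerE.
have c1_poly k : exists q : {poly K}, forall t, c (t, 0) k = q.[t].
  by have [q qE] := c_poly k; exists q.[0%:P] => t; rewrite qE.
have [P PE] := meval_poly2 g c_poly.
have [b0 b0E] := meval_poly B c1_poly; have [e0 e0E] := meval_poly e c1_poly.
have free D : block_free D -> forall t y, D.@[c (t, y)] = D.@[c (t, 0)].
  move=> freeD t y; apply: freeD => k neq_k; rewrite /c (negPf (neq_k j0)).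
  by case: existsP.
have free1 D : block_free D -> D.@[c (1, 0)] = D.@[fun=> 1].
  move=> freeD; apply: freeD => k neq_k; rewrite /c (negPf (neq_k j0)).
  case: existsP => [[j kj]|_ /=]; first by have := neq_k j; rewrite kj.
  by rewrite mul1r addrC subrK.
pose A := \prod_(j < m | j != j0) v0 (f j) ^+ l j.
have nzA : A != 0.
  by apply/prodf_neq0 => j nej; rewrite expf_neq0 // nz_v0.
have TE t y : T.@[c (t, y)] = y ^+ l j0 * A.
  rewrite meval_block (bigD1 j0) //= {1}/c eqxx; congr (_ * _).
  apply: eq_bigr => j nej; rewrite /c (inj_eq f_inj) (negPf nej).
  by case: existsP => // -[]; exists j.
have cE : c (0, v0 (f j0)) =1 v0.
  move=> k; rewrite /c; case: eqP => [->//|_]; case: ifP => // _ /=.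
  by rewrite mul0r addr0.
have bE t : (- A^-1 *: b0).[t] = - (B.@[c (t, 0)] / A).
  by rewrite hornerZ -b0E mulNr mulrC.
have onF t y : T.@[c (t, y)] + B.@[c (t, y)] = 0 <->
    y ^+ l j0 = (- A^-1 *: b0).[t].
  rewrite bE TE (free B) //; split=> [/eqP|->].
    by rewrite addr_eq0 => /eqP E; rewrite -mulNr -E mulfK.
  by rewrite mulNr divfK // addNr.
have nz_b : - A^-1 *: b0 != 0.
  apply: contra_neq B1 => /(congr1 (fun q => q.[1])); rewrite bE horner0.
  move/eqP; rewrite oppr_eq0 mulf_eq0 invr_eq0 (negPf nzA) orbF => /eqP <-.
  by rewrite (free1 B).
have nz_e : e0 != 0.
  apply: contra_neq e1 => e00; move: (e0E 1); rewrite e00 horner0 => <-.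
  by rewrite (free1 e).
rewrite -(meval_eq g cE) PE /=.
apply: (radical_curve_dense charK0 (l_gt0 j0) nz_b nz_e); last first.
  by apply/onF; rewrite !(meval_eq _ cE).
move=> t y /onF Fty bt et; rewrite -(PE (t, y)); apply: g_gen => //.
  apply: contraNneq bt; rewrite (free B) // => Bt.
  by rewrite bE Bt mul0r oppr0.
by rewrite (free e) // e0E.
Qed.

(** Two vanishing coordinates of the block keep the block monomial equal to [0]
    when all of them but one move, so a point with several vanishing coordinates
    is a limit of points with a single one. *)
Lemma block_dense (v0 : 'I_n -> K) : (0 < m)%N ->
  T.@[v0] + B.@[v0] = 0 -> g.@[v0] = 0.
Proof.
move=> m_gt0 Fv0.
have [/existsP[j0 /eqP v00]|] := boolP [exists j, v0 (f j) == 0]; last first.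
  rewrite negb_exists => /forallP nz.
  apply: (@block_dense_one _ (Ordinal m_gt0)).
    by move=> j _; apply: nz.
  by [].
pose c t k :=
  if [exists j, [&& j != j0, k == f j & v0 k == 0]] then t else v0 k.
have c_poly k : exists q : {poly K}, forall t, c t k = q.[t].
  rewrite /c; case: existsP => _; first by exists 'X => t; rewrite hornerX.
  by exists (v0 k)%:P => t; rewrite hornerC.
have [p pE] := meval_poly g c_poly.
have cE : c 0 =1 v0.
  by move=> k; rewrite /c; case: existsP => // -[j /and3P[_ _ /eqP]].
have T0 v : v (f j0) = 0 -> T.@[v] = 0.
  move=> vj0; rewrite meval_block (bigD1 j0) //= vj0 expr0n.
  by rewrite gtn_eqF ?mul0r.
have B0 t : B.@[c t] = 0.
  have <- : B.@[v0] = 0 by rewrite -Fv0 T0 // add0r.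
  apply: freeB => k nek; rewrite /c; case: existsP => // -[j].
  by rewrite (negPf (nek j)) andbF.
have cj0 t : c t (f j0) = 0.
  rewrite /c v00; case: existsP => // -[j /and3P[]].
  by rewrite (inj_eq f_inj) eq_sym => /negPf->.
rewrite -(meval_eq g cE) pE (@poly_eq0_dense _ p 'X) ?horner0 ?polyX_eq0 //.
move=> t; rewrite hornerX -pE => nz_t; apply: (@block_dense_one _ j0).
  move=> j nej; rewrite /c; case: existsP => // no; apply/negP => z.
  by apply: no; exists j; rewrite nej eqxx.
by rewrite T0 // B0 addr0.
Qed.

End Density.

(** * Regular functions on a hypersurface *)

Section RegularFunctions.
Variables (K : closedFieldType) (n : nat) (X : set 'rV[K]_n).
Implicit Types (p q : {mpoly K[n]}) (f g : coordinate_ring X) (x : X).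

Definition coords x : 'I_n -> K := fun i => set_val x ord0 i.

Fact restriction_subproof p :
  (fun x : X => p.@[coords x]) \in @regular_function K n X.
Proof. by apply/regular_functionP; exists p. Qed.

Definition restriction p : coordinate_ring X :=
  CoordinateRing (restriction_subproof p).

Lemma restrictionE p x : restriction p x = p.@[coords x].
Proof. by []. Qed.

Lemma coordinate_ring_eq f g : (forall x, f x = g x) -> f = g.
Proof. by move=> fg; apply/val_inj/funext. Qed.

Lemma restriction_onto f : exists p, f = restriction p.
Proof.
have /regular_functionP[p fp] := valP f.
by exists p; apply: coordinate_ring_eq => x; rewrite restrictionE -fp.
Qed.

Lemma restrictionD p q : restriction (p + q) = restriction p + restriction q.
Proof. by apply: coordinate_ring_eq => x; rewrite restrictionE mevalD. Qed.

Lemma restrictionM p q : restriction (p * q) = restriction p * restriction q.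
Proof. by apply: coordinate_ring_eq => x; rewrite restrictionE mevalM. Qed.

Lemma restrictionC c : restriction c%:MP = c *: (1 : coordinate_ring X).
Proof.
apply: coordinate_ring_eq => x; rewrite restrictionE mevalC.
by rewrite -[RHS]/(c * 1) mulr1.
Qed.

Lemma coords_inj x y : coords x =1 coords y -> x = y.
Proof. by move=> xy; apply: val_inj; apply/rowP => i; apply: xy. Qed.

End RegularFunctions.

Section Hypersurface.
Variables (K : closedFieldType) (n : nat) (F : {mpoly K[n]}).

Fact hypersurface_point_subproof (v : 'I_n -> K) :
  F.@[v] = 0 -> (\row_i v i) \in hypersurface F.
Proof.
move=> Fv; apply/mem_set; rewrite /hypersurface /mkset -[RHS]Fv.
by apply: meval_eq => i; rewrite mxE.
Qed.

Definition hypersurface_point (v : 'I_n -> K) (Fv : F.@[v] = 0) :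
  hypersurface F := exist _ (\row_i v i) (hypersurface_point_subproof Fv).

Lemma coords_point v (Fv : F.@[v] = 0) : coords (hypersurface_point Fv) =1 v.
Proof. by move=> i; rewrite /coords mxE. Qed.

Lemma coords_hypersurface (x : hypersurface F) : F.@[coords x] = 0.
Proof. exact: (set_mem (valP x)). Qed.

End Hypersurface.

(** * The one-parameter group of a locally nilpotent derivation *)

Section Flow.
Variables (K : closedFieldType) (charK0 : [pchar K] =i pred0).
Variables (n : nat) (F : {mpoly K[n]}).
Local Notation X := (hypersurface F).
Local Notation A := (coordinate_ring X).
Variable D : {linear A -> A}.
Hypotheses (D_der : derivation D) (D_nil : locally_nilpotent D).
Implicit Types (f g : A) (x : X) (p q : {poly K}).

Lemma iter_derivation0 k : iter k D 0 = 0.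
Proof. by elim: k => //= k ->; rewrite raddf0. Qed.

Lemma derivation_const c : D (restriction X c%:MP) = 0.
Proof.
rewrite restrictionC linearZ /=.
have := D_der 1 1; rewrite !mulr1 mul1r => /eqP.
rewrite -subr_eq0 opprD addrA subrr add0r oppr_eq0 => /eqP->.
by rewrite scaler0.
Qed.

(** The Taylor series at [s = 0] of [f] along the integral curve of [D] through
    [x]. It is a polynomial in [s] since [D] is locally nilpotent. *)
Definition flow_poly x f : {poly K} :=
  \poly_(k < projT1 (cid (D_nil f))) (iter k D f x / k`!%:R).

Lemma derivn_flow_poly x f k : (flow_poly x f)^`(k).[0] = iter k D f x.
Proof.
rewrite horner_coef0 coef_derivn addn0 ffactnn coef_poly.
case: cid => d /= [_ Df]; case: ltnP => [_|le_dk].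
  by rewrite -[LHS]mulr_natr divfK // natr_neq0 // fact_gt0.
by rewrite -(subnK le_dk) iterD Df mul0rn iter_derivation0.
Qed.

Lemma derivn0_inj p q : (forall k, p^`(k).[0] = q^`(k).[0]) -> p = q.
Proof.
move=> pq; apply/polyP => k; have := pq k.
rewrite !horner_coef0 !coef_derivn addn0 ffactnn => /eqP.
rewrite -[p`_k *+ _]mulr_natr -[q`_k *+ _]mulr_natr.
rewrite -subr_eq0 -mulrBl mulf_eq0 subr_eq0.
by rewrite (negPf (natr_neq0 _ _)) ?fact_gt0 // orbF => /eqP.
Qed.

Lemma flow_poly_unique x f p :
  (forall k, p^`(k).[0] = iter k D f x) -> flow_poly x f = p.
Proof. by move=> pE; apply: derivn0_inj => k; rewrite derivn_flow_poly pE. Qed.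

Lemma flow_poly_at0 x f : (flow_poly x f).[0] = f x.
Proof. exact: (derivn_flow_poly x f 0). Qed.

Lemma flow_poly_deriv x f : flow_poly x (D f) = (flow_poly x f)^`().
Proof.
by apply: flow_poly_unique => k; rewrite -derivSn derivn_flow_poly iterSr.
Qed.

Lemma flow_polyD x f g : flow_poly x (f + g) = flow_poly x f + flow_poly x g.
Proof.
apply: flow_poly_unique => k; rewrite derivnD hornerD !derivn_flow_poly.
suff -> : iter k D (f + g) = iter k D f + iter k D g by [].
by elim: k => //= k ->; rewrite raddfD.
Qed.

Lemma flow_polyM x f g : flow_poly x (f * g) = flow_poly x f * flow_poly x g.
Proof.
apply: flow_poly_unique => k; elim: k f g => [|k IHk] f g.
  by rewrite hornerM !flow_poly_at0.
rewrite derivSn derivM -!flow_poly_deriv derivnD hornerD !IHk iterSr D_der.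
suff -> : iter k D (D f * g + f * D g) =
    iter k D (D f * g) + iter k D (f * D g) by [].
by elim: k {IHk} => //= k ->; rewrite raddfD.
Qed.

Lemma flow_polyC x c : flow_poly x (restriction X c%:MP) = c%:P.
Proof.
apply: flow_poly_unique => -[|k].
  by rewrite hornerC; apply/esym/mevalC.
rewrite derivSn derivC iterSr derivation_const linear0 horner0.
by rewrite iter_derivation0.
Qed.

Lemma flow_polyE x s (p : {mpoly K[n]}) : (flow_poly x (restriction X p)).[s] =
  p.@[fun i => (flow_poly x (restriction X 'X_i)).[s]].
Proof.
elim/mpoly_ring_ind: p => [c|i|p q IHp IHq|p q IHp IHq].
- by rewrite flow_polyC hornerC mevalC.
- by rewrite mevalXU.
- by rewrite restrictionD flow_polyD hornerD mevalD IHp IHq.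
- by rewrite restrictionM flow_polyM hornerM mevalM IHp IHq.
Qed.

Lemma flow_onX x s : F.@[fun i => (flow_poly x (restriction X 'X_i)).[s]] = 0.
Proof.
rewrite -flow_polyE (_ : restriction X F = restriction X 0%:MP).
  by rewrite flow_polyC hornerC.
apply: coordinate_ring_eq => y.
by rewrite !restrictionE mevalC coords_hypersurface.
Qed.

Definition flow s x : X := hypersurface_point (flow_onX x s).

Lemma flowE s x f : f (flow s x) = (flow_poly x f).[s].
Proof.
have [p ->] := restriction_onto f; rewrite restrictionE flow_polyE.
by apply: meval_eq => i; rewrite coords_point.
Qed.

(** Taylor expansion at [s]. *)
Lemma flow_poly_flow s x f :
  flow_poly (flow s x) f = flow_poly x f \Po ('X + s%:P).
Proof.
apply: flow_poly_unique => k.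
rewrite flowE (_ : _^`(k) = (flow_poly x f)^`(k) \Po ('X + s%:P)).
  rewrite horner_comp !hornerE; elim: k f => // k IHk f.
  by rewrite iterSr derivSn -flow_poly_deriv IHk.
elim: k => [|k IHk] //; rewrite derivnS IHk deriv_comp derivD derivX derivC.
by rewrite addr0 mulr1 -derivnS.
Qed.

Lemma flow_cancel s : cancel (flow s) (flow (- s)).
Proof.
move=> x; apply: coords_inj => i.
have E y : coords y i = restriction X 'X_i y by rewrite restrictionE mevalXU.
by rewrite !E flowE flow_poly_flow horner_comp !hornerE addNr flow_poly_at0.
Qed.

Lemma flow_regular s : regular_map (flow s).
Proof.
move=> i; set d := projT1 (cid (D_nil (restriction X 'X_i))).
pose h : A := \sum_(k < d) (s ^+ k / k`!%:R) *: iter k D (restriction X 'X_i).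
rewrite (_ : (fun _ => _) = h); first exact: valP.
apply: funext => x; rewrite -[LHS]/(coords (flow s x) i) coords_point.
rewrite horner_poly /h -/d.
have valS : (coordinate_ring_val h) x = \sum_(k < d)
    ((s ^+ k / k`!%:R) *: iter k D (restriction X 'X_i) : A) x.
  by rewrite /h; elim/big_rec2: _ => // k y f _ <-.
rewrite [RHS]valS; apply: eq_bigr => k _.
rewrite -[RHS]/(s ^+ k / k`!%:R * iter k D (restriction X 'X_i) x).
by rewrite mulrAC (mulrC _ (s ^+ k)) mulrAC.
Qed.

Lemma flow_Aut s : Aut (flow s).
Proof.
split; first exact: flow_regular.
exists (flow (- s)); split; [exact: flow_regular | exact: flow_cancel |].
by move=> x; have := flow_cancel (- s) x; rewrite opprK.
Qed.

End Flow.

(** * Orbits of the automorphism group *)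

Section AutomorphismGroup.
Variables (K : closedFieldType) (n : nat) (X : set 'rV[K]_n).

Lemma regular_map_comp (f g : X -> X) :
  regular_map f -> regular_map g -> regular_map (f \o g).
Proof.
move=> freg greg i; have /regular_functionP[p fp] := freg i.
rewrite (_ : (fun _ => _) = (fun x => p.@[coords (g x)] : K^o)); last first.
  by apply: funext => x; rewrite /= fp.
apply: (meval_closed (S := fun h : X -> K =>
  (h : X -> K^o) \in @regular_function K n X)) => [c|h1 h2 r1 r2|h1 h2 r1 r2|j].
- by apply/regular_functionP; exists c%:MP => x; rewrite mevalC.
- exact: (rpredD r1 r2).
- exact: (rpredM r1 r2).
- exact: greg.
Qed.

Lemma Aut_comp (f g : X -> X) : Aut f -> Aut g -> Aut (f \o g).
Proof.
move=> [fr [f' [f'r fK f'K]]] [gr [g' [g'r gK g'K]]].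
split; first exact: regular_map_comp.
exists (g' \o f'); split; first exact: regular_map_comp.
  by move=> x /=; rewrite fK gK.
by move=> x /=; rewrite g'K f'K.
Qed.

Lemma Aut_orbit_eq (f : X -> X) x : Aut f -> Aut_orbit (f x) = Aut_orbit x.
Proof.
move=> Af; have [fr [f' [f'r fK f'K]]] := Af.
have Af' : Aut f' by split => //; exists f.
apply/seteqP; split=> [_ [h Ah <-]|_ [h Ah <-]].
  by exists (h \o f) => //; apply: Aut_comp.
by exists (h \o f'); [apply: Aut_comp | rewrite /= fK].
Qed.

End AutomorphismGroup.

Lemma finite_range_finType (T U : Type) (C : finType) (c : T -> C)
    (phi : T -> set U) :
  (forall x y, c x = c y -> phi x = phi y) -> finite_set (range phi).
Proof.
move=> cphi.
(* The union of [phi] over a fibre of [c], on which [phi] is constant. *)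
pose f k := [set z | exists2 y, c y = k & phi y z].
apply: (@sub_finite_set _ _ [set f k | k in [set: C]]); last first.
  exact/finite_image/finite_finset.
move=> _ [x _ <-]; exists (c x) => //.
by apply/seteqP; split=> [z [y /cphi <-]|z] //; exists x.
Qed.

(** * Diagonal scalings *)

Lemma block_eq0 (K : closedFieldType) (n m : nat) (f : 'I_m -> 'I_n)
    (l : 'I_m -> nat) (l_gt0 : forall j, (0 < l j)%N) (v : 'I_n -> K) :
  ((block_monomial K f l).@[v] == 0) = [exists j, v (f j) == 0].
Proof.
rewrite meval_block; apply/prodf_eq0/existsP => [[j _]|[j vj]].
  by rewrite expf_eq0 => /andP[_ vj]; exists j.
by exists j; rewrite // expf_eq0 l_gt0.
Qed.

(** A vanishing coordinate leaves its scaling factor free, so any value of the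
    monomial can be reached by taking a root; without vanishing coordinates the
    factors are determined, and [u] is the value that they give. *)
Lemma block_scaling (K : closedFieldType) (m : nat) (l : 'I_m -> nat)
    (x y : 'I_m -> K) (u : K) :
    (forall j, (0 < l j)%N) -> (forall j, (x j == 0) = (y j == 0)) -> u != 0 ->
    \prod_j y j ^+ l j = u * \prod_j x j ^+ l j ->
  exists t : 'I_m -> K, [/\ forall j, t j != 0, forall j, y j = t j * x j &
    \prod_j t j ^+ l j = u].
Proof.
move=> l_gt0 xy nz_u yux.
pose r j := if x j == 0 then 1 else y j / x j.
have nz_r j : r j != 0.
  rewrite /r; case: ifPn; rewrite ?oner_eq0 // => xj.
  by rewrite mulf_neq0 ?invr_eq0 // -xy.
have rE j : y j = r j * x j.
  rewrite /r; case: ifPn => [xj|xj]; last by rewrite divfK.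
  by rewrite (eqP xj) mulr0; apply/eqP; rewrite -xy.
have [[j0 xj0]|no0] := pselect (exists j, x j == 0); last first.
  exists r; split => //; apply: (@mulIf _ (\prod_j x j ^+ l j)).
    apply/prodf_neq0 => j _; rewrite expf_neq0 //.
    by apply/negP => xj; apply: no0; exists j.
  by rewrite -yux -big_split; apply: eq_bigr => j _; rewrite rE exprMn.
pose a := \prod_(j | j != j0) r j ^+ l j.
have nz_a : a != 0 by apply/prodf_neq0 => j _; rewrite expf_neq0.
have [w] : exists w, root ('X^(l j0) - (u / a)%:P) w.
  by apply/closed_rootP; rewrite size_XnsubC // eqSS -lt0n.
rewrite rootE !hornerE subr_eq0 => /eqP wE.
exists (fun j => if j == j0 then w else r j); split=> [j|j|].
- case: (eqVneq j j0) => // _; apply/eqP => w0; move: wE.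
  rewrite w0 expr0n gtn_eqF // => /esym/eqP.
  by rewrite mulf_eq0 invr_eq0 (negPf nz_u) (negPf nz_a).
- case: (eqVneq j j0) => [->|//]; rewrite (eqP xj0) mulr0.
  by apply/eqP; rewrite -xy.
- rewrite (bigD1 j0) //= eqxx wE (eq_bigr (fun j => r j ^+ l j)) ?divfK //.
  by move=> j /negPf->.
Qed.

(** On the line [a0 + a1 + a2 = 0] of the projective plane, the only points with
    a vanishing coordinate are [(0 : 1 : -1)], [(1 : 0 : -1)] and
    [(1 : -1 : 0)], which are told apart by this coordinate. *)
Lemma proportional_triples (K : fieldType) (a0 a1 a2 b0 b1 b2 : K) :
    a0 + a1 + a2 = 0 -> b0 + b1 + b2 = 0 ->
    (a0 == 0) = (b0 == 0) -> (a1 == 0) = (b1 == 0) -> (a2 == 0) = (b2 == 0) ->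
    (a0 != 0 -> a1 != 0 -> a2 != 0 -> b1 * a0 = a1 * b0) ->
  exists u, [/\ u != 0, b0 = u * a0, b1 = u * a1 & b2 = u * a2].
Proof.
move=> /eqP; rewrite addrC addr_eq0 => /eqP->.
move=> /eqP; rewrite [b0 + _ + _]addrC addr_eq0 => /eqP->; rewrite !oppr_eq0.
have [->|nz0] := eqVneq a0 0.
  move/esym/eqP->; rewrite !add0r; have [->|nz1] := eqVneq a1 0.
    by move/esym/eqP-> => _ _; exists 1; rewrite oner_eq0 !(oppr0, mulr0).
  move/esym/negbT => nzb1 _ _; exists (b1 / a1).
  by rewrite mulr0 mulrN divfK // mulf_neq0 ?invr_eq0.
move/esym/negbT => nzb0 E1 E2 E; exists (b0 / a0).
rewrite mulrN mulrDr divfK // mulf_neq0 ?invr_eq0 //.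
suff -> : b1 = b0 / a0 * a1 by [].
have [z1|nz1] := eqVneq a1 0.
  by rewrite z1 mulr0; apply/eqP; rewrite -E1 z1.
have [z2|nz2] := eqVneq (a0 + a1) 0.
  move: E2; rewrite z2 eqxx => /esym; rewrite addr_eq0 => /eqP E2.
  move: z2 => /eqP; rewrite addr_eq0 => /eqP a0E.
  by rewrite E2 -[a1]opprK -a0E mulrN divfK // opprK.
by apply: (mulIf nz0); rewrite E // ?oppr_eq0 // mulrAC divfK // mulrC.
Qed.

(** * Trinomial hypersurfaces *)

Section Trinomial.
Variables (K : closedFieldType) (charK0 : [pchar K] =i pred0).
Variables (n0 n1 n2 : nat) (n1_ge1 : (1 <= n1)%N).
Variables (l0 : 'I_n0 -> nat) (l1 : 'I_n1 -> nat) (l2 : 'I_n2 -> nat).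
Hypotheses (l0_gt0 : forall j, (0 < l0 j)%N) (l1_gt0 : forall j, (0 < l1 j)%N)
  (l2_gt0 : forall j, (0 < l2 j)%N).

Local Notation N := (n0 + n1 + n2)%N.
Local Notation F := (trinomial K l0 l1 l2).
Local Notation X := (trinomial_hypersurface K l0 l1 l2).

Definition index0 (j : 'I_n0) : 'I_N := lshift n2 (lshift n1 j).
Definition index1 (j : 'I_n1) : 'I_N := lshift n2 (rshift n0 j).
Definition index2 (j : 'I_n2) : 'I_N := rshift (n0 + n1) j.

Local Notation T0 := (block_monomial K index0 l0).
Local Notation T1 := (block_monomial K index1 l1).
Local Notation T2 := (block_monomial K index2 l2).

Lemma index_ind (P : 'I_N -> Prop) : (forall j, P (index0 j)) ->
  (forall j, P (index1 j)) -> (forall j, P (index2 j)) -> forall i, P i.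
Proof.
move=> P0 P1 P2 i; case: (split_ordP i) => [j ->|j ->]; last exact: P2.
by case: (split_ordP j) => [k ->|k ->]; [apply: P0 | apply: P1].
Qed.

Lemma trinomialE : F = T0 + T1 + T2. Proof. by []. Qed.

Lemma trinomial_eq0 (x : X) :
  T0.@[coords x] + T1.@[coords x] + T2.@[coords x] = 0.
Proof. by rewrite -!mevalD -trinomialE coords_hypersurface. Qed.

Lemma block2_sum (x : X) : T2.@[coords x] = - (T0.@[coords x] + T1.@[coords x]).
Proof. by apply/eqP; rewrite -addr_eq0 addrC trinomial_eq0. Qed.

Definition off_axes (x : X) :=
  [/\ T0.@[coords x] != 0, T1.@[coords x] != 0 & T2.@[coords x] != 0].

Lemma off_axesP x : off_axes x <-> forall i, coords x i != 0.
Proof.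
split=> [[]|nz].
  rewrite !block_eq0 // !negb_exists => /forallP ? /forallP ? /forallP ?.
  exact: index_ind.
by split; rewrite block_eq0 // negb_exists; apply/forallP => j.
Qed.

(** The quasitorus of diagonal matrices that scale the three blocks by the same
    factor acts on the hypersurface. Its orbits are determined by the vanishing
    coordinates and, when there are none, by the ratio of two of the blocks. *)
Lemma torus_orbit (x y : X) :
    (forall i, (coords x i == 0) = (coords y i == 0)) ->
    (off_axes x -> T1.@[coords y] * T0.@[coords x] =
                   T1.@[coords x] * T0.@[coords y]) ->
  Aut_orbit y = Aut_orbit x.
Proof.
move=> xy ratio.
have eq0 m (f : 'I_m -> 'I_N) l : (forall j, 0 < l j)%N ->
    ((block_monomial K f l).@[coords x] == 0) =
    ((block_monomial K f l).@[coords y] == 0).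
  by move=> l_gt0; rewrite !block_eq0 //; apply: eq_existsb => j; apply: xy.
have [u [nz_u]] := proportional_triples (trinomial_eq0 x) (trinomial_eq0 y)
  (eq0 _ _ _ l0_gt0) (eq0 _ _ _ l1_gt0) (eq0 _ _ _ l2_gt0)
  (fun z0 z1 z2 => ratio (And3 z0 z1 z2)).
rewrite !meval_block.
move=> /(block_scaling l0_gt0 (fun j => xy (index0 j)) nz_u)[t0 [nz0 y0 p0]].
move=> /(block_scaling l1_gt0 (fun j => xy (index1 j)) nz_u)[t1 [nz1 y1 p1]].
move=> /(block_scaling l2_gt0 (fun j => xy (index2 j)) nz_u)[t2 [nz2 y2 p2]].
pose t : 'rV[K]_N := row_mx (row_mx (\row_j t0 j) (\row_j t1 j)) (\row_j t2 j).
have tE0 j : t ord0 (index0 j) = t0 j by rewrite !row_mxEl mxE.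
have tE1 j : t ord0 (index1 j) = t1 j by rewrite row_mxEl row_mxEr mxE.
have tE2 j : t ord0 (index2 j) = t2 j by rewrite row_mxEr mxE.
have nz_t i : t ord0 i != 0.
  by elim/index_ind: i => j; rewrite ?tE0 ?tE1 ?tE2.
have yE i : coords y i = t ord0 i * coords x i.
  by elim/index_ind: i => j; rewrite ?tE0 ?tE1 ?tE2.
have scaleF (a : 'I_N -> K) c (z : X) :
    (\prod_j a (index0 j) ^+ l0 j = c) -> (\prod_j a (index1 j) ^+ l1 j = c) ->
    (\prod_j a (index2 j) ^+ l2 j = c) -> F.@[fun i => a i * coords z i] = 0.
  move=> a0 a1 a2; rewrite trinomialE !mevalD !meval_block.
  have dist m (f : 'I_m -> 'I_N) l : \prod_j (a (f j) * coords z (f j)) ^+ l j =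
      \prod_j a (f j) ^+ l j * (block_monomial K f l).@[coords z].
    by rewrite meval_block -big_split; apply: eq_bigr => j _; rewrite exprMn.
  by rewrite !dist a0 a1 a2 -!mulrDr trinomial_eq0 mulr0.
have tF (z : X) : F.@[fun i => t ord0 i * coords z i] = 0.
  by apply: (scaleF (t ord0) u); [rewrite -p0|rewrite -p1|rewrite -p2];
    apply: eq_bigr => j _; rewrite ?tE0 ?tE1 ?tE2.
have tVF (z : X) : F.@[fun i => (t ord0 i)^-1 * coords z i] = 0.
  by apply: (scaleF (fun i => (t ord0 i)^-1) u^-1);
    [rewrite -p0|rewrite -p1|rewrite -p2];
    rewrite -prodfV; apply: eq_bigr => j _; rewrite ?tE0 ?tE1 ?tE2 exprVn.
pose ft (z : X) : X := hypersurface_point (tF z).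
pose ftV (z : X) : X := hypersurface_point (tVF z).
have reg (a : 'I_N -> K) (h : X -> X) :
    (forall z i, coords (h z) i = a i * coords z i) -> regular_map h.
  move=> hE i; apply/regular_functionP; exists ((a i)%:MP * 'X_i) => z.
  by rewrite mevalM mevalC mevalXU -hE.
have -> : y = ft x by apply: coords_inj => i; rewrite coords_point yE.
apply: Aut_orbit_eq; split.
  by apply: (reg (t ord0)) => z i; rewrite coords_point.
exists ftV; split.
- by apply: (reg (fun i => (t ord0 i)^-1)) => z i; rewrite coords_point.
- by move=> z; apply: coords_inj => i; rewrite !coords_point mulKf.
- by move=> z; apply: coords_inj => i; rewrite !coords_point mulVKf.
Qed.

Lemma free_block01 : block_free index1 T0.
Proof.
move=> v w vw; rewrite !meval_block; apply: eq_bigr => j _; rewrite vw // => k.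
by rewrite /index0 /index1 eq_lshift eq_lrshift.
Qed.

Lemma free_block21 : block_free index1 T2.
Proof.
move=> v w vw; rewrite !meval_block; apply: eq_bigr => j _; rewrite vw // => k.
by rewrite /index2 /index1 eq_rlshift.
Qed.

Lemma index1_inj : injective index1.
Proof. by move=> j k /lshift_inj/rshift_inj. Qed.

Section Nilpotent.
Variable D : {linear coordinate_ring X -> coordinate_ring X}.
Hypotheses (D_der : derivation D) (D_nil : locally_nilpotent D).

Local Notation curve := (flow_poly D_nil).
Local Notation curve0 x := (curve x (restriction X T0)).
Local Notation curve1 x := (curve x (restriction X T1)).

(** Since [T1 / T0] is a nonconstant rational function along the curve through
    [x], it takes all but finitely many values there, so the curve crosses all
    but finitely many of the torus orbits off the coordinate hyperplanes. *)
Lemma orbits_finite_of_wronskian (x : X) :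
    curve0 x * (curve1 x)^`() != curve1 x * (curve0 x)^`() ->
  finite_set (range (Aut_orbit (X := X))).
Proof.
move=> /wronskian_surj[r rP].
pose ratio (y : X) := T1.@[coords y] / T0.@[coords y].
have good y : off_axes y -> ratio y \notin r -> Aut_orbit y = Aut_orbit x.
  move=> off_y /rP[s]; have [y0 y1 y2] := off_y.
  have Aflow := flow_Aut charK0 D_der D_nil s.
  rewrite -!(flowE charK0 D_der) !restrictionE.
  set w := flow _ _ _ _ _ => w1 w0; rewrite -(Aut_orbit_eq x Aflow) -/w.
  have off_w : off_axes w.
    split=> //; first by rewrite w1 !mulf_neq0 ?invr_eq0.
    move: y2; rewrite !block2_sum w1 !oppr_eq0 => y2.
    rewrite -{1}[T0.@[coords w]]mul1r -mulrDl mulf_neq0 //.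
    apply: contraNneq y2 => E; rewrite -[T1.@[coords y]](divfK y0) -/(ratio y).
    by rewrite -{1}[T0.@[coords y]]mul1r -mulrDl E mul0r.
  apply: torus_orbit => [i|_]; last by rewrite w1 /ratio mulrAC divfK.
  move/off_axesP: off_y => /(_ i)/negPf->.
  by move/off_axesP: off_w => /(_ i)/negPf->.
(* The index [size r] stands for all the ratios outside [r] at once. *)
pose c y := ([set i | coords y i == 0]%SET,
             inord (index (ratio y) r) : 'I_(size r).+1).
apply: (@finite_range_finType _ _ _ c) => y z [/setP supp].
move=> /(congr1 val) /=; rewrite !inordK ?ltnS ?index_size // => idx.
have yz i : (coords z i == 0) = (coords y i == 0).
  by have := supp i; rewrite !inE.
have [y_r|y_r] := boolP (ratio y \in r).
  apply: torus_orbit => // -[z0 z1 z2].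
  have y0 : T0.@[coords y] != 0.
    move: z0; rewrite !block_eq0 //; apply: contra => /existsP[j yj].
    by apply/existsP; exists j; rewrite yz.
  have rat : ratio y = ratio z.
    by rewrite -(nth_index 0 y_r) idx nth_index // -index_mem -idx index_mem.
  by rewrite -[T1.@[coords y]](divfK y0) -/(ratio y) rat /ratio mulrAC divfK.
have z_r : ratio z \notin r by rewrite -index_mem -idx index_mem.
have [off_y|on_y] := pselect (off_axes y).
  rewrite good // good //; apply/off_axesP => i; rewrite yz.
  by move: i; apply/off_axesP.
apply: torus_orbit => // off_z; case: on_y; apply/off_axesP => i; rewrite -yz.
by move: i; apply/off_axesP.
Qed.

Hypothesis wronskian0 : forall x,
  curve0 x * (curve1 x)^`() = curve1 x * (curve0 x)^`().

(** At a point with [T0 = 0] and [T1 != 0] the curve stays in [T0 = 0] because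
    [T0 / T1] is constant along it. Such points are dense in each component
    [T0_j = 0, T1 + T2 = 0] of the divisor [T0 = 0]. *)
Lemma divisor_invariant (x : X) : T0.@[coords x] = 0 -> curve0 x = 0.
Proof.
move=> x0; have /existsP[j0 /eqP xj0] : [exists j, coords x (index0 j) == 0].
  by rewrite -(block_eq0 index0 l0_gt0) x0.
apply: (flow_poly_unique charK0) => k.
have derivn_0 : (0 : {poly K})^`(k) = 0.
  by elim: k => // k IHk; rewrite derivnS IHk deriv0.
rewrite derivn_0.
have [g gE] := restriction_onto (iter k D (restriction X T0)).
have [g' g'E] := meval_zero_coord g (index0 j0).
rewrite horner0 gE restrictionE.
have -> : g.@[coords x] = g'.@[coords x].
  by rewrite g'E; apply: meval_eq => i; case: eqP => // ->.
apply/esym.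
apply: (@block_dense _ charK0 _ _ index1 l1 index1_inj l1_gt0 T2 1);
  last 2 first.
- by [].
- by rewrite -(trinomial_eq0 x) x0 add0r.
- exact: free_block21.
- by move=> v w _; rewrite !meval1.
- by rewrite block_at1 oner_eq0.
- by rewrite meval1 oner_eq0.
move=> v Fv v2 _; rewrite g'E; set w := fun i => _.
have w0 : T0.@[w] = 0.
  by apply/eqP; rewrite block_eq0 //; apply/existsP; exists j0; rewrite /w eqxx.
have w1 : T1.@[w] = T1.@[v].
  rewrite !meval_block; apply: eq_bigr => j _; rewrite /w.
  by rewrite /index0 /index1 eq_lshift eq_rlshift.
have w2 : T2.@[w] = T2.@[v].
  rewrite !meval_block; apply: eq_bigr => j _; rewrite /w.
  by rewrite /index0 /index2 eq_rlshift.
have Fw : F.@[w] = 0 by rewrite trinomialE !mevalD w0 w1 w2 add0r.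
have wE := coords_point Fw; set z : X := hypersurface_point Fw in wE.
rewrite -(meval_eq g wE) -restrictionE -gE -(derivn_flow_poly charK0 D_nil).
rewrite (wronskian0_eq0 charK0 (wronskian0 z)).
- by rewrite derivn_0 horner0.
- by rewrite flow_poly_at0 // restrictionE (meval_eq _ wE).
- rewrite flow_poly_at0 // restrictionE (meval_eq _ wE) w1.
  by apply: contraNneq v2 => v1; rewrite -Fv v1 add0r.
Qed.

(** The curve through a point off the coordinate hyperplanes never meets the
    invariant divisor [T0 = 0], so [T0] is a polynomial without zeros along it;
    [T1] is then constant too, since [T0 / T1] is. *)
Lemma off_axes_flow (y : X) s :
  off_axes y -> off_axes (flow charK0 D_der D_nil s y).
Proof.
move=> [y0 y1 y2].
have val0 f : (curve y f).[0] = f y by rewrite flow_poly_at0.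
have size0 : size (curve0 y) == 1.
  apply/negPn/negP => /closed_rootP[r].
  rewrite rootE -(flowE charK0 D_der) => /eqP/divisor_invariant.
  rewrite flow_poly_flow => /(congr1 (fun p => p.[- r])).
  rewrite horner_comp !hornerE addNr val0 restrictionE => /eqP.
  by rewrite (negPf y0).
have [c _ E0] := size_poly1P _ size0.
have E1 : (curve1 y)^`() = 0.
  have := wronskian0 y; rewrite E0 derivC mulr0 => /eqP; rewrite mulf_eq0.
  case/orP => /eqP // c0; move: y0; rewrite -restrictionE -val0 E0.
  by move: c0 => ->; rewrite horner0 eqxx.
have {}E1 : curve1 y = (T1.@[coords y])%:P.
  apply: derivn0_inj => // -[|k]; first by rewrite val0 hornerC restrictionE.
  by rewrite !derivSn E1 derivC.
have {}E0 : curve0 y = (T0.@[coords y])%:P.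
  by rewrite -restrictionE -val0 E0 hornerC.
have w0 : T0.@[coords (flow charK0 D_der D_nil s y)] = T0.@[coords y].
  by rewrite -restrictionE flowE E0 hornerC.
have w1 : T1.@[coords (flow charK0 D_der D_nil s y)] = T1.@[coords y].
  by rewrite -restrictionE flowE E1 hornerC.
by split; rewrite ?w0 ?w1 // block2_sum w0 w1 -block2_sum.
Qed.

(** A polynomial function of the time without zeros is constant. *)
Lemma off_axes_derivation_coord (y : X) i :
  off_axes y -> D (restriction X 'X_i) y = 0.
Proof.
move=> off_y; rewrite -(derivn_flow_poly charK0 D_nil y (restriction X 'X_i) 1).
suff /size_poly1P[c _ ->] : size (curve y (restriction X 'X_i)) == 1.
  by rewrite derivn1 derivC horner0.
apply/negPn/negP => /closed_rootP[s]; rewrite rootE -(flowE charK0 D_der).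
have /off_axesP/(_ i)/negPf := off_axes_flow s off_y.
by rewrite restrictionE mevalXU => ->.
Qed.

Lemma derivation_eq0 f : D f = 0.
Proof.
have DX i : D (restriction X 'X_i) = 0.
  have [g gE] := restriction_onto (D (restriction X 'X_i)).
  apply: coordinate_ring_eq => x; rewrite gE restrictionE.
  apply: (@block_dense _ charK0 _ _ index1 l1 index1_inj l1_gt0
    (T0 + T2) (T0 * T2)).
  - move=> v w vw; rewrite !mevalD.
    by rewrite (free_block01 vw) (free_block21 vw).
  - move=> v w vw; rewrite !mevalM.
    by rewrite (free_block01 vw) (free_block21 vw).
  - by rewrite mevalD !block_at1 -(natrD _ 1 1) natr_neq0.
  - by rewrite mevalM !block_at1 mulr1 oner_eq0.
  - move=> v; rewrite mevalD mevalM mulf_eq0 negb_or => Fv v02 /andP[v0 v2].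
    have Fv' : F.@[v] = 0 by rewrite trinomialE !mevalD -Fv; ring.
    have vE := coords_point Fv'; set y : X := hypersurface_point Fv' in vE.
    rewrite -(meval_eq g vE) -restrictionE -gE off_axes_derivation_coord //.
    split; rewrite (meval_eq _ vE) //.
    by apply: contraNneq v02 => v1; rewrite -Fv v1 add0r.
  - by [].
  - by rewrite mevalD -(trinomial_eq0 x); ring.
have [p ->] := restriction_onto f.
elim/mpoly_ring_ind: p => [c|//|p q Dp Dq|p q Dp Dq].
- exact: derivation_const.
- by rewrite restrictionD linearD /= Dp Dq addr0.
- by rewrite restrictionM D_der Dp Dq mul0r mulr0 addr0.
Qed.

End Nilpotent.
End Trinomial.

Theorem corollary4p4 (K : closedFieldType) (charK0 : [pchar K] =i pred0)
    (n0 n1 n2 : nat) (n1_ge1 : (1 <= n1)%N) (n2_ge1 : (1 <= n2)%N)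
    (l0 : 'I_n0 -> nat) (l1 : 'I_n1 -> nat) (l2 : 'I_n2 -> nat)
    (l0_gt0 : forall j, (0 < l0 j)%N)
    (l1_gt0 : forall j, (0 < l1 j)%N)
    (l2_gt0 : forall j, (0 < l2 j)%N)
    (nonrigid : ~ rigid (trinomial_hypersurface K l0 l1 l2)) :
  finite_set (range (Aut_orbit (X := trinomial_hypersurface K l0 l1 l2))).
Proof.
apply: contrapT => infinite; apply: nonrigid => D D_der D_nil.
apply: (derivation_eq0 charK0 n1_ge1 l0_gt0 l1_gt0 l2_gt0 D_der
  (D_nil := D_nil)) => x.
apply/eqP/negPn/negP => W; apply: infinite.
exact: (orbits_finite_of_wronskian charK0 l0_gt0 l1_gt0 l2_gt0 D_der W).
Qed.
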